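(* Suppose $(X,f)$ is a dynamical system. If $(X,f)$ satisfies the 'multi-horseshoe' dense property, then for any continuous function $\varphi:X\to\mathbb{R}$, any $a\in \mathrm{Int}(\mathcal{P}_{\varphi}(\mathcal{M}_f(X)))$, any $\mu\in \mathcal{P}_{\varphi}^{-1}(a)$ and any $\zeta>0$, there is a compact invariant subset $\Lambda\subset X$ such that $a\in \mathrm{Int}(\mathcal{P}_{\varphi}(\mathcal{M}_f(\Lambda)))$, $\rho(\mu,\nu)<\zeta$ for any $\nu\in \mathcal{M}_f(\Lambda)$, and $(\Lambda,f)$ conjugates to a transitive two-sided subshift of finite type.
   Context: A dynamical system $(X,f)$: $(X,d)$ compact metric space, $f:X\to X$ continuous. $\mathcal{M}(X)$ is the set of Borel probability measures, $\mathcal{M}_f(X)$ the $f$-invariant ones, with weak* metric $\rho(\xi,\tau)=\sum_{j\ge1}\frac{|\int\varphi_j d\xi-\int\varphi_j d\tau|}{2^j\|\varphi_j\|}$, $\{\varphi_j\}$ a fixed dense sequence in $C(X)$. For $\Lambda\subset X$ compact with $f(\Lambda)=\Lambda$, $\mathcal{M}_f(\Lambda)$ is the set of invariant measures supported on $\Lambda$. $\mathcal{P}_\varphi(\mu)=\int\varphi\,d\mu$; $\mathrm{Int}$ is interior in $\mathbb{R}$. $h_\mu(f)$ is metric entropy and $h_{top}(f,\Lambda)$ topological entropy of $f$ on $\Lambda$. $d_H(A,B)=\max\{\sup_{\mu\in A}\inf_{\nu\in B}\rho(\mu,\nu),\sup_{\nu\in B}\inf_{\mu\in A}\rho(\nu,\mu)\}$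 for nonempty $A,B\subset\mathcal{M}(X)$ (a single measure is identified with a singleton), and $\mathrm{cov}\{\mu_i\}_{i=1}^m=\{\sum_i t_i\mu_i:t_i\in[0,1],\sum_i t_i=1\}$. $(X,f)$ satisfies the 'multi-horseshoe' dense property if for any positive integer $m$, any $\{\mu_i\}_{i=1}^m\subseteq\mathcal{M}_f(X)$, any $x\in X$ and any $\eta,\zeta>0$, there exist compact invariant subsets $\Lambda_i\subseteq\Lambda\subsetneq X$ such that for each $1\le i\le m$: (1) $(\Lambda_i,f)$ and $(\Lambda,f)$ conjugate to transitive two-sided subshifts of finite type; (2) $h_{top}(f,\Lambda_i)>h_{\mu_i}(f)-\eta$; (3) $d_H(K,\mathcal{M}_f(\Lambda))<\zeta$ and $d_H(\mu_i,\mathcal{M}_f(\Lambda_i))<\zeta$, where $K=\mathrm{cov}\{\mu_i\}_{i=1}^m$. $(X,f)$ conjugates to $(Y,g)$ if there is a homeomorphism $\pi:X\to Y$ with $\pi\circ f=g\circ\pi$. Transitive: for all non-empty open $U,V$ there is an integer $n$ with $f^n(U)\cap V\neq\emptyset$. A two-sided subshift of finite type is a closed shift-invariant subset of $\{0,\dots,k-1\}^{\mathbb{Z}}$ consisting exactly of the sequences all of whose blocks of length $N+1$ belong to a prescribed collection, for some natural number $N$. *)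

(* Defs.v *)
From HB Require Import structures.
From mathcomp Require Import all_boot all_order all_algebra.
From mathcomp Require Import all_classical all_reals all_analysis.

Set Implicit Arguments.
Unset Strict Implicit.
Unset Printing Implicit Defensive.

Import Order.TTheory GRing.Theory Num.Theory.
Import numFieldNormedType.Exports.

Local Open Scope classical_set_scope.
Local Open Scope ring_scope.

(* The library's measurable types are pointed, hence so is the space; the base
   point plays no role and only records that the space is nonempty. *)
#[short(type="pointedMetricType")]
HB.structure Definition PointedMetric (K : numDomainType) :=
  {M of Metric K M & Pointed M}.

Definition borel (X : ptopologicalType) := g_sigma_algebraType (@open X).

Section InvariantMeasures.
Context {R : realType} {X : pointedMetricType R}.
Local Notation measureX := (probability (borel X) R).

Definition invariant_measure (f : X -> X) (mu : measureX) : Prop :=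
  forall A : set (borel X), measurable A -> mu (f @^-1` A) = mu A.

(* [inv_measures f setT] is the set of all invariant measures. *)
Definition inv_measures (f : X -> X) (L : set X) : set measureX :=
  [set mu | invariant_measure f mu /\ mu L = 1%E].

Definition integral_map (phi : X -> R) (mu : measureX) : R :=
  Rintegral mu [set: borel X] phi.

Definition sup_norm (phi : X -> R) : R := sup [set `|phi x| | x in [set: X]].

Definition dense_in_C (phi_ : nat -> X -> R) : Prop :=
  (forall j, continuous (phi_ j)) /\
  (forall (g : X -> R) (e : R), continuous g -> 0 < e ->
     exists j, sup_norm (fun x => phi_ j x - g x) < e).

(* Indices start at 0 here, whence the exponent [j.+1]. A term with
   [phi_ j = 0], if any, vanishes, since [x / 0 = 0]. *)
Definition rho (phi_ : nat -> X -> R) (xi tau : measureX) : R :=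
  limn (series (fun j =>
    `|integral_map (phi_ j) xi - integral_map (phi_ j) tau|
      / (2 ^+ j.+1 * sup_norm (phi_ j)))).

(* Valued in the extended reals, so that the distance from a nonempty set to
   the empty set is [+oo]. *)
Definition hausdorff_dist (phi_ : nat -> X -> R) (A B : set measureX) : \bar R :=
  maxe
    (ereal_sup [set ereal_inf [set (rho phi_ mu nu)%:E | nu in B] | mu in A])
    (ereal_sup [set ereal_inf [set (rho phi_ nu mu)%:E | mu in A] | nu in B]).

Definition cov (m : nat) (mu : 'I_m -> measureX) : set measureX :=
  [set nu | exists t : 'I_m -> R,
    [/\ forall i, 0 <= t i <= 1,
        \sum_(i < m) t i = 1 &
        forall A : set (borel X), measurable A ->
          nu A = (\sum_(i < m) (t i)%:E * mu i A)%E]].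

End InvariantMeasures.

Section MetricEntropy.
Context {R : realType} {X : pointedMetricType R}.
Local Notation measureX := (probability (borel X) R).

Definition measurable_partition (k : nat) (P : 'I_k -> set X) : Prop :=
  [/\ forall i, measurable (P i : set (borel X)),
      trivIset [set: 'I_k] P &
      \bigcup_(i in [set: 'I_k]) P i = [set: X]].

(* The cell, with itinerary [w], of the join of the partitions [f^-i P],
   [0 <= i < n]. *)
Definition join_cell (f : X -> X) (k : nat) (P : 'I_k -> set X) (n : nat)
    (w : {ffun 'I_n -> 'I_k}) : set X :=
  \bigcap_(i in [set: 'I_n]) (iter i f @^-1` P (w i)).

Definition join_entropy (f : X -> X) (mu : measureX) (k : nat)
    (P : 'I_k -> set X) (n : nat) : R :=
  - \sum_(w : {ffun 'I_n -> 'I_k})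
      (fine (mu (join_cell f P w)) * ln (fine (mu (join_cell f P w)))).

Definition partition_entropy (f : X -> X) (mu : measureX) (k : nat)
    (P : 'I_k -> set X) : R :=
  limn (fun n => join_entropy f mu P n / n%:R).

Definition metric_entropy (f : X -> X) (mu : measureX) : \bar R :=
  ereal_sup [set h | exists (k : nat) (P : 'I_k -> set X),
    measurable_partition P /\ h = (partition_entropy f mu P)%:E].

End MetricEntropy.

Section TopologicalEntropy.
Context {R : realType} {X : metricType R}.

(* [s] lists, without repetition, an (n, e)-separated subset of [L]. *)
Definition separated (f : X -> X) (L : set X) (n : nat) (e : R) (s : seq X)
    : Prop :=
  [/\ uniq s,
      forall x, x \in s -> L x &
      forall x y, x \in s -> y \in s -> x != y ->
        exists2 i : nat, (i < n)%N & e < mdist (iter i f x) (iter i f y)].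

Definition separated_number (f : X -> X) (L : set X) (n : nat) (e : R)
    : \bar R :=
  ereal_sup [set (size s)%:R%:E | s in separated f L n e].

Definition top_entropy (f : X -> X) (L : set X) : \bar R :=
  lim (limn_esup (fun n => (n%:R^-1)%:E * lne (separated_number f L n e))%E
    @[e --> 0^'+]).

End TopologicalEntropy.

Section Systems.
Context {X Y : topologicalType}.

Definition compact_invariant (f : X -> X) (L : set X) : Prop :=
  compact L /\ f @` L = L.

(* [p] and [q] are total functions; only their restrictions to [A] and [B],
   which are mutually inverse homeomorphisms, are used. *)
Definition conjugate (A : set X) (f : X -> X) (B : set Y) (g : Y -> Y) : Prop :=
  exists (p : X -> Y) (q : Y -> X),
    [/\ (forall x, A x -> B (p x) /\ q (p x) = x),
        (forall y, B y -> A (q y) /\ p (q y) = y),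
        {within A, continuous p},
        {within B, continuous q} &
        forall x, A x -> p (f x) = g (p x)].

End Systems.

Section Subshifts.

(* The product topology on {0, ..., k-1}^Z, each factor being discrete. *)
Definition full_shift (k : nat) : topologicalType :=
  {ptws int -> discrete_topology 'I_k}.

Definition shiftz (k : nat) (n : int) (x : full_shift k) : full_shift k :=
  fun i => x (i + n).

Definition shift (k : nat) : full_shift k -> full_shift k := @shiftz k 1.

Definition block (k N : nat) (x : full_shift k) (i : int)
    : {ffun 'I_N.+1 -> 'I_k} :=
  [ffun j : 'I_N.+1 => x (i + (j : nat)%:Z)].

Definition finite_type_subshift (k : nat) (Y : set (full_shift k)) : Prop :=
  [/\ closed Y,
      @shift k @` Y = Y &
      exists (N : nat) (F : {set {ffun 'I_N.+1 -> 'I_k}}),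
        Y = [set x | forall i : int, block N x i \in F]].

Definition transitive_subshift (k : nat) (Y : set (full_shift k)) : Prop :=
  forall U V : set (full_shift k), open U -> open V ->
    Y `&` U !=set0 -> Y `&` V !=set0 ->
    exists n : int, (@shiftz k n @` (Y `&` U)) `&` (Y `&` V) !=set0.

Definition conj_transitive_sft (X : topologicalType) (f : X -> X) (L : set X)
    : Prop :=
  exists (k : nat) (Y : set (full_shift k)),
    [/\ finite_type_subshift Y, transitive_subshift Y &
        conjugate L f Y (@shift k)].

End Subshifts.

Definition multi_horseshoe_dense (R : realType) (X : pointedMetricType R)
    (phi_ : nat -> X -> R) (f : X -> X) : Prop :=
  forall (m : nat) (mu : 'I_m -> probability (borel X) R) (x : X)
      (eta zeta : R),
    (0 < m)%N -> (forall i, inv_measures f [set: X] (mu i)) ->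
    0 < eta -> 0 < zeta ->
  exists (L : set X) (Li : 'I_m -> set X),
    [/\ compact_invariant f L,
        L `<` [set: X],
        (forall i, compact_invariant f (Li i)),
        (forall i, Li i `<=` L) &
        forall i,
          [/\ conj_transitive_sft f (Li i) /\ conj_transitive_sft f L,
              (metric_entropy f (mu i) - eta%:E < top_entropy f (Li i))%E,
              (hausdorff_dist phi_ (cov mu) (inv_measures f L) < zeta%:E)%E &
              (hausdorff_dist phi_ [set mu i] (inv_measures f (Li i))
                 < zeta%:E)%E]].

(* Main.v *)
(* Since a is interior, there are invariant nu1, nu2 with integrals of phi on
   either side of a. The measures k_i = t nu_i + (1 - t) mu are still strictly
   on either side of a, and for small t their whole segment is rho-close to mu.
   Let L be a horseshoe approximating that segment in the Hausdorff distance: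
   its invariant measures are close to the segment, hence to mu, and some of
   them are close to k_1 and to k_2, hence have integrals on either side of a.
   By convexity all intermediate values are attained. *)
Require Import Defs.
From HB Require Import structures.
From mathcomp Require Import all_boot all_order all_algebra.
From mathcomp Require Import all_classical all_reals all_analysis.
From mathcomp Require Import measurable_realfun.
From mathcomp Require Import ring lra.

Set Implicit Arguments.
Unset Strict Implicit.
Unset Printing Implicit Defensive.

Import Order.TTheory GRing.Theory Num.Theory.
Import numFieldNormedType.Exports.

Local Open Scope classical_set_scope.
Local Open Scope ring_scope.

(** * Convex combinations of two probability measures and their integrals *)

Section ProbabilityIntegral.
Context {d : measure_display} {T : measurableType d} {R : realType}.
Implicit Types (mu nu kappa : probability T R) (g : T -> R) (t C : R).

(** Restricted to measurable sets because membership in [cov] gives the formula only there. *)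
Definition is_mixture t mu nu kappa :=
  forall A, measurable A ->
    kappa A = (t%:E * mu A + (1 - t)%:E * nu A)%E.

(* The formula holds for all [A], not only measurable ones, so that it can be
   used at a preimage [f @^-1` A] without knowing [f] to be measurable. *)
Lemma mixture_exists t mu nu : 0 <= t <= 1 ->
  exists kappa, forall A, kappa A = (t%:E * mu A + (1 - t)%:E * nu A)%E.
Proof.
move=> /andP[t0 t1].
have t1' : 0 <= 1 - t by rewrite subr_ge0.
pose m : {measure set T -> \bar R} :=
  measure_add (mscale (NngNum t0) mu) (mscale (NngNum t1') nu).
have mE A : m A = (t%:E * mu A + (1 - t)%:E * nu A)%E.
  exact: measure_addE.
have m1 : m setT = 1%E.
  by rewrite mE !probability_setT !mule1 -EFinD addrC subrK.
pose P := Measure_isProbability.Build _ _ _ m m1.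
pose k : probability T R := HB.pack (Measure.sort m) (Measure.class m) P.
by exists k.
Qed.

Lemma bounded_integrable mu g C : measurable_fun setT g ->
  (forall x, `|g x| <= C) -> mu.-integrable setT (EFin \o g).
Proof.
move=> mg gC; apply: measurable_bounded_integrable => //.
  by rewrite (le_lt_trans (probability_le1 mu measurableT))// ltry.
exists C; split; first exact: num_real.
by move=> M CM x _; exact: le_trans (gC x) (ltW CM).
Qed.

Lemma le_normr_Rintegral_bound mu g C : measurable_fun setT g ->
  (forall x, `|g x| <= C) -> `|Rintegral mu setT g| <= C.
Proof.
move=> mg gC; have ig := bounded_integrable mu mg gC.
apply: (le_trans (le_normr_Rintegral measurableT ig)).
have -> : C = Rintegral mu setT (cst C).
  by rewrite Rintegral_cst// [X in fine X]probability_setT mulr1.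
apply: le_Rintegral => //.
- apply: (@bounded_integrable _ _ C); first exact: measurableT_comp.
  by move=> x; rewrite normr_id.
- exact: (@bounded_integrable _ _ `|C|).
Qed.

(** Integrals of nonnegative functions are additive and homogeneous in the measure. Hence [g] is
    shifted to [h = g + C >= 0]; the added constants cancel at the end because [t + (1 - t) = 1]. *)
Lemma Rintegral_mixture t mu nu kappa g C : 0 <= t <= 1 ->
  is_mixture t mu nu kappa -> measurable_fun setT g ->
  (forall x, `|g x| <= C) ->
  Rintegral kappa setT g =
    t * Rintegral mu setT g + (1 - t) * Rintegral nu setT g.
Proof.
move=> /andP[t0 t1] kE mg gC.
have t1' : 0 <= 1 - t by rewrite subr_ge0.
pose h x := g x + C.
have mh : measurable_fun setT h by exact: measurable_funD.
have h0 x : 0 <= h x.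
  by have := gC x; rewrite /h ler_norml => /andP[]; rewrite -subr_ge0 opprK.
have hC x : `|h x| <= C + `|C|.
  by rewrite (le_trans (ler_normD _ _))// lerD2r.
have hE (m : probability T R) : Rintegral m setT h = Rintegral m setT g + C.
  rewrite RintegralD//; [|exact: bounded_integrable mg gC|]; last first.
    exact: (@bounded_integrable _ _ `|C|).
  by rewrite Rintegral_cst// [X in fine X]probability_setT mulr1.
have hk : (\int[kappa]_(x in setT) (h x)%:E =
    t%:E * \int[mu]_(x in setT) (h x)%:E +
    (1 - t)%:E * \int[nu]_(x in setT) (h x)%:E)%E.
  rewrite (eq_measure_integral
    (measure_add (mscale (NngNum t0) mu) (mscale (NngNum t1') nu))); last first.
    move=> A mA _; apply: etrans; first exact: kE.
    exact/esym/measure_addE.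
  have mhE : measurable_fun setT (fun x => (h x)%:E) by apply/measurable_EFinP.
  have h0E x : [set: T] x -> (0 <= (h x)%:E)%E by rewrite lee_fin.
  by rewrite ge0_integral_measure_add// !ge0_integral_mscale.
(* Finiteness is what lets [fine] commute with the sum and products in [hk]. *)
have fin (m : probability T R) : (\int[m]_(x in setT) (h x)%:E)%E \is a fin_num.
  exact: integrable_fin_num (bounded_integrable m mh hC).
have : Rintegral kappa setT h =
    t * Rintegral mu setT h + (1 - t) * Rintegral nu setT h.
  by rewrite /Rintegral hk -[in LHS](fineK (fin mu)) -[in LHS](fineK (fin nu)).
rewrite !hE; lra.
Qed.

End ProbabilityIntegral.

(** * Integrals of continuous functions on a compact space *)

Section WeakStarMetric.
Context {R : realType} {X : pointedMetricType R}.
Local Notation measureX := (probability (borel X) R).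
Hypothesis cX : compact [set: X].
Implicit Types (mu nu kappa : measureX) (g : X -> R).

Lemma continuous_borel_measurable g :
  continuous g -> measurable_fun [set: borel X] (g : borel X -> R).
Proof.
move=> /continuousP cg; apply: (measurability _ (RGenOpens.measurableE R)).
move=> _ [_ [a [b ->] <-]]; rewrite setTI.
by apply: sub_sigma_algebra; apply: cg; exact: interval_open.
Qed.

(** Compactness makes [g] bounded, so that [sup] is a true least upper bound and not a default
    value. *)
Lemma le_sup_norm g x : continuous g -> `|g x| <= sup_norm g.
Proof.
move=> cg; apply: ub_le_sup; last by exists x.
have : compact (g @` [set: X]).
  by apply: continuous_compact => //; exact: continuous_subspaceT.
move=> /compact_bounded[M [_ gM]]; exists (M + 1) => _ [y _ <-].
by apply: gM; [rewrite ltrDl|exists y].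
Qed.

Lemma sup_norm_ge0 g : continuous g -> 0 <= sup_norm g.
Proof. by move=> cg; apply: le_trans (le_sup_norm point cg). Qed.

Lemma integral_map_mixture t mu nu kappa g : 0 <= t <= 1 ->
  is_mixture t mu nu kappa -> continuous g ->
  integral_map g kappa = t * integral_map g mu + (1 - t) * integral_map g nu.
Proof.
move=> t01 kE cg; apply: (Rintegral_mixture t01 kE) => [|x].
  exact: continuous_borel_measurable.
exact: le_sup_norm.
Qed.

Lemma integral_map_bound mu g : continuous g ->
  `|integral_map g mu| <= sup_norm g.
Proof.
move=> cg; apply: le_normr_Rintegral_bound => [|x].
  exact: continuous_borel_measurable.
exact: le_sup_norm.
Qed.

Lemma integral_mapB mu g h : continuous g -> continuous h ->
  integral_map (fun x => g x - h x) mu = integral_map g mu - integral_map h mu.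
Proof.
move=> cg ch; apply: RintegralB => //;
  by apply: bounded_integrable => [|x];
    [exact: continuous_borel_measurable|exact: le_sup_norm].
Qed.

Lemma integral_map_dist mu nu g : continuous g ->
  `|integral_map g mu - integral_map g nu| <= 2 * sup_norm g.
Proof.
move=> cg; rewrite (le_trans (ler_normB _ _))//.
have := integral_map_bound mu cg; have := integral_map_bound nu cg; lra.
Qed.

Lemma inv_measures_mixture (f : X -> X) (L : set X) t mu nu kappa :
  0 <= t <= 1 ->
  (forall A, kappa A = (t%:E * mu A + (1 - t)%:E * nu A)%E) ->
  inv_measures f L mu -> inv_measures f L nu -> inv_measures f L kappa.
Proof.
move=> t01 kE [imu muL] [inu nuL]; split.
  by move=> A mA; rewrite !kE imu// inu.
by rewrite kE muL nuL !mule1 -EFinD addrC subrK.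
Qed.

(** * The weak* metric *)

Section Rho.
Variable phi_ : nat -> X -> R.
Hypothesis dphi : dense_in_C phi_.

Let cphi j : continuous (phi_ j). Proof. by case: dphi. Qed.

Let dist_term mu nu j :=
  `|integral_map (phi_ j) mu - integral_map (phi_ j) nu|
    / (2 ^+ j.+1 * sup_norm (phi_ j)).

Let dist_term_ge0 mu nu j : 0 <= dist_term mu nu j.
Proof. by rewrite divr_ge0// mulr_ge0// sup_norm_ge0. Qed.

Let dist_term_le mu nu (c : R) :
  0 <= c ->
  (forall j, `|integral_map (phi_ j) mu - integral_map (phi_ j) nu|
     <= c * sup_norm (phi_ j)) ->
  forall j, dist_term mu nu j <= c / (2 ^ (j + 1))%:R.
Proof.
move=> c0 le_c j; rewrite /dist_term addn1 natrX.
(* If the norm is 0, the term is 0 by the convention [x / 0 = 0]. *)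
have [->|s0] := eqVneq (sup_norm (phi_ j)) 0.
  by rewrite mulr0 invr0 mulr0 divr_ge0.
have s_gt0 : 0 < sup_norm (phi_ j) by rewrite lt_def s0 sup_norm_ge0.
rewrite ler_pdivrMr ?mulr_gt0// mulrA divfK ?expf_neq0//.
Qed.

Let cvg_half (c : R) : series (fun j => c / (2 ^ (j + 1))%:R : R) @ \oo --> c.
Proof. by have := cvg_geometric_series_half c 0; rewrite expr0 divr1. Qed.

(** Comparison with a geometric series: two integrals of [phi_ j] differ by at most twice its
    norm. *)
Let cvg_dist mu nu : cvgn (series (dist_term mu nu)).
Proof.
apply: (@series_le_cvg _ _ (fun j => 2 / (2 ^ (j + 1))%:R)).
- exact: dist_term_ge0.
- by move=> j; rewrite divr_ge0.
- by apply: dist_term_le => // j; exact: integral_map_dist.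
- by apply/cvg_ex; exists 2; exact: cvg_half.
Qed.

(** The weights [1 / 2 ^+ j.+1] sum to 1. *)
Lemma rho_le mu nu (c : R) : 0 <= c ->
  (forall j, `|integral_map (phi_ j) mu - integral_map (phi_ j) nu|
     <= c * sup_norm (phi_ j)) ->
  rho phi_ mu nu <= c.
Proof.
move=> c0 le_c; rewrite -(cvg_lim _ (@cvg_half c))//.
apply: lim_series_le; first exact: cvg_dist.
  by apply/cvg_ex; exists c; exact: cvg_half.
exact: dist_term_le.
Qed.

Lemma rho_sym mu nu : rho phi_ mu nu = rho phi_ nu mu.
Proof.
by congr (limn (series _)); apply/funext => j; rewrite distrC.
Qed.

Lemma rho_triangle mu nu kappa :
  rho phi_ mu nu <= rho phi_ mu kappa + rho phi_ kappa nu.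
Proof.
rewrite /rho -lim_seriesD; [|exact: cvg_dist..].
apply: lim_series_le; first exact: cvg_dist.
  by apply: is_cvg_seriesD; exact: cvg_dist.
move=> j; rewrite -[leRHS]mulrDl ler_wpM2r ?ler_distD//.
by rewrite invr_ge0 mulr_ge0// sup_norm_ge0.
Qed.

(** A single term of a nonnegative series is at most its sum. *)
Lemma le_rho mu nu j :
  `|integral_map (phi_ j) mu - integral_map (phi_ j) nu| <=
    rho phi_ mu nu * (2 ^+ j.+1 * sup_norm (phi_ j)).
Proof.
(* Here the term of the series says nothing about the integrals, but both of them agree since
   [phi_ j] has norm 0. *)
have [s0|s0] := eqVneq (sup_norm (phi_ j)) 0.
  rewrite s0 !mulr0; have := integral_map_dist mu nu (@cphi j).
  by rewrite s0 mulr0.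
have s_gt0 : 0 < sup_norm (phi_ j) by rewrite lt_def s0 sup_norm_ge0.
rewrite -ler_pdivrMr ?mulr_gt0//.
have nd : nondecreasing_seq (series (dist_term mu nu)).
  by apply: nondecreasing_series => n _ _; exact: dist_term_ge0.
(* The partial sum of index [j.+1] is the first one containing term [j]. *)
apply: le_trans (nondecreasing_cvgn_le nd (@cvg_dist mu nu) j.+1).
rewrite seriesSr lerDr; apply: sumr_ge0 => n _; exact: dist_term_ge0.
Qed.

(** Replace [g] by some [phi_ j] within [e / 4]: the two replacements and the bound [le_rho] on
    [phi_ j] each cost less than [e / 4]. *)
Lemma integral_map_rho_continuous g (e : R) : continuous g -> 0 < e ->
  exists2 r : R, 0 < r & forall mu nu, rho phi_ mu nu < r ->
    `|integral_map g mu - integral_map g nu| < e.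
Proof.
move=> cg e0.
have [j gj] := dphi.2 g (e / 4) cg ltac:(lra).
have cB : continuous (fun x => phi_ j x - g x).
  by move=> x; apply: cvgB; [exact: cphi|exact: cg].
have near_g mu : `|integral_map (phi_ j) mu - integral_map g mu| < e / 4.
  rewrite -integral_mapB//; apply: le_lt_trans gj; exact: integral_map_bound.
(* The summand 1 keeps [M] positive even if [phi_ j] is 0; [rho0] below absorbs the extra
   [rho phi_ mu nu]. *)
pose M := 2 ^+ j.+1 * sup_norm (phi_ j) + 1.
have s0 : 0 <= 2 ^+ j.+1 * sup_norm (phi_ j) by rewrite mulr_ge0// sup_norm_ge0.
have M0 : 0 < M by rewrite /M; lra.
exists (e / 4 / M); first by rewrite divr_gt0//; lra.
move=> mu nu; rewrite ltr_pdivlMr// => rM.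
have rho0 : 0 <= rho phi_ mu nu.
  apply: limr_ge; first exact: cvg_dist.
  by apply: nearW => n; apply: sumr_ge0 => k _; exact: dist_term_ge0.
have := le_rho mu nu j; have := near_g mu; have := near_g nu.
move: rM; rewrite /M mulrDr mulr1 !ltr_norml => rM /andP[? ?] /andP[? ?].
rewrite ler_norml => /andP[? ?]; apply/andP; split; lra.
Qed.

End Rho.
End WeakStarMetric.

(** A strict upper bound on an infimum is beaten by some member of the set, so an actual measure
    within [z] exists. *)
Lemma hausdorff_dist_lt (R : realType) (X : pointedMetricType R)
    (phi_ : nat -> X -> R) (A B : set (probability (borel X) R)) (z : R) :
  (hausdorff_dist phi_ A B < z%:E)%E ->
  (forall mu, A mu -> exists2 nu, B nu & rho phi_ mu nu < z) /\
  (forall nu, B nu -> exists2 mu, A mu & rho phi_ nu mu < z).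
Proof.
rewrite /hausdorff_dist gt_max => /andP[supA supB]; split.
  move=> mu Amu.
  have /ereal_inf_lt[_ [nu Bnu <-]] :
      (ereal_inf [set (rho phi_ mu nu)%:E | nu in B] < z%:E)%E.
    by apply: le_lt_trans supA; apply: ereal_sup_ubound; exists mu.
  by rewrite lte_fin; exists nu.
move=> nu Bnu.
have /ereal_inf_lt[_ [mu Amu <-]] :
    (ereal_inf [set (rho phi_ nu mu)%:E | mu in A] < z%:E)%E.
  by apply: le_lt_trans supB; apply: ereal_sup_ubound; exists nu.
by rewrite lte_fin; exists mu.
Qed.

Definition pair_family (T : Type) (x y : T) (i : 'I_2) : T :=
  if i == ord0 then x else y.

Lemma cov_pairP (R : realType) (X : pointedMetricType R)
    (mu nu kappa : probability (borel X) R) :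
  cov (pair_family mu nu) kappa ->
  exists2 s : R, 0 <= s <= 1 & is_mixture s mu nu kappa.
Proof.
move=> [s [s01 s1 kE]]; exists (s ord0) => // A mA.
rewrite kE//; move: s1; rewrite !big_ord_recl !big_ord0 !addr0 => <-.
by rewrite /pair_family /= [s ord0 + _]addrC addrK.
Qed.

Lemma cov_pair (R : realType) (X : pointedMetricType R)
    (mu nu : probability (borel X) R) :
  cov (pair_family mu nu) mu /\ cov (pair_family mu nu) nu.
Proof.
split; [exists (pair_family 1 0)|exists (pair_family 0 1)];
  (split; [by move=> i; rewrite /pair_family; case: ifP; rewrite ?lexx ?ler01
          |by rewrite !big_ord_recl big_ord0 /pair_family /= addr0 ?addr0 ?add0r
          |move=> A mA; rewrite !big_ord_recl big_ord0 /pair_family /=]).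
  by rewrite mul1e mul0e !adde0.
by rewrite mul1e mul0e adde0 add0e.
Qed.

(** * Choice of the segment and of the horseshoe *)

Theorem corollary1p11 (R : realType) (X : pointedMetricType R) (f : X -> X)
    (phi_ : nat -> X -> R)
    (cX : compact [set: X]) (cf : continuous f) (dphi : dense_in_C phi_) :
  multi_horseshoe_dense phi_ f ->
  forall (phi : X -> R) (a : R) (mu : probability (borel X) R) (zeta : R),
    continuous phi ->
    interior (integral_map phi @` inv_measures f [set: X]) a ->
    inv_measures f [set: X] mu -> integral_map phi mu = a ->
    0 < zeta ->
  exists L : set X,
    [/\ compact_invariant f L,
        interior (integral_map phi @` inv_measures f L) a,
        (forall nu, inv_measures f L nu -> rho phi_ mu nu < zeta) &
        conj_transitive_sft f L].
Proof.
move=> mhd phi a mu zeta cphi a_int imu mu_a zeta0.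
have /nbhs_ballP[e /= e0 ball_sub] := a_int.
have [nu1 inu1 nu1E] : (integral_map phi @` inv_measures f [set: X]) (a - e / 2).
  by apply: ball_sub; rewrite /ball/= ltr_norml; apply/andP; split; lra.
have [nu2 inu2 nu2E] : (integral_map phi @` inv_measures f [set: X]) (a + e / 2).
  by apply: ball_sub; rewrite /ball/= ltr_norml; apply/andP; split; lra.
(* The segment will lie within [2 * t <= zeta / 2] of [mu]. *)
have [t t0 [t1 t_zeta]] : exists2 t : R, 0 < t & t <= 1 /\ t <= zeta / 4.
  exists (Num.min 1 (zeta / 4)); first by rewrite lt_min ltr01/=; lra.
  by rewrite !ge_min !lexx orbT.
have t01 : 0 <= t <= 1 by rewrite (ltW t0).
have [k1 k1E] := mixture_exists nu1 mu t01.
have [k2 k2E] := mixture_exists nu2 mu t01.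
have k1_mix : is_mixture t nu1 mu k1 by move=> A _.
have k2_mix : is_mixture t nu2 mu k2 by move=> A _.
have k1_int := integral_map_mixture cX t01 k1_mix cphi.
have k2_int := integral_map_mixture cX t01 k2_mix cphi.
(* The integrals of [phi] against [k1] and [k2] are [a - t * e / 2] and [a + t * e / 2]. *)
have gap0 : 0 < t * e / 2 by rewrite divr_gt0// mulr_gt0.
have [r r0 int_near] := integral_map_rho_continuous cX dphi cphi gap0.
(* [z <= r] keeps the approximations of [k1] and [k2] on their sides of [a]; [z <= zeta / 4] leaves
   a total distance to [mu] below [zeta]. *)
have [z z0 [zr z_zeta]] : exists2 z : R, 0 < z & z <= r /\ z <= zeta / 4.
  exists (Num.min r (zeta / 4)); first by rewrite lt_min r0/=; lra.
  by rewrite !ge_min !lexx orbT.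
have ik i : inv_measures f [set: X] (pair_family k1 k2 i).
  by rewrite /pair_family; case: ifP => _;
    [exact: inv_measures_mixture k1E _ _|exact: inv_measures_mixture k2E _ _].
(* The clauses about [L] do not depend on the index, so they are read off at [ord0]. *)
have [L [Li [cL _ _ _ /(_ ord0)[[_ L_sft] _ /hausdorff_dist_lt[near1 near2] _]]]] :=
  mhd 2 (pair_family k1 k2) point 1 z isT ik ltr01 z0.
have [cov1 cov2] := cov_pair k1 k2.
have [l1 il1 l1z] := near1 _ cov1.
have [l2 il2 l2z] := near1 _ cov2.
have l1_lt : integral_map phi l1 < a.
  have := int_near _ _ (lt_le_trans l1z zr).
  rewrite k1_int nu1E mu_a ltr_norml => /andP[+ _]; lra.
have l2_gt : a < integral_map phi l2.
  have := int_near _ _ (lt_le_trans l2z zr).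
  rewrite k2_int nu2E mu_a ltr_norml => /andP[_]; lra.
exists L; split => //.
- apply: (@filterS _ _ _ `]integral_map phi l1, integral_map phi l2[%classic); last first.
    by apply: near_in_itvoo; rewrite in_itv/= l1_lt l2_gt.
  move=> c /=; rewrite in_itv/= => /andP[l1c cl2].
  set b1 := integral_map phi l1 in l1c l1_lt *.
  set b2 := integral_map phi l2 in cl2 l2_gt *.
  have b12 : 0 < b2 - b1 by lra.
  (* The solution of [s * b1 + (1 - s) * b2 = c]. *)
  pose s := (b2 - c) / (b2 - b1).
  have s01 : 0 <= s <= 1.
    by rewrite /s divr_ge0 ?ler_pdivrMr ?mul1r//=; lra.
  have [l lE] := mixture_exists l1 l2 s01.
  exists l; first exact: inv_measures_mixture lE _ _.
  have l_mix : is_mixture s l1 l2 l by move=> A _.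
  rewrite (integral_map_mixture cX s01 l_mix cphi) -/b1 -/b2 /s.
  by field; rewrite gt_eqF.
- move=> nu iL; have [k /cov_pairP[s s01 k_mix] nuk] := near2 _ iL.
  apply: (le_lt_trans (rho_triangle cX dphi mu nu k)).
  rewrite [rho _ k nu]rho_sym.
  have : rho phi_ mu k <= 2 * t.
    apply: (rho_le cX dphi) => [|j]; first by rewrite mulr_ge0// ltW.
    have cj := dphi.1 j.
    rewrite (integral_map_mixture cX s01 k_mix cj).
    rewrite (integral_map_mixture cX t01 k1_mix cj).
    rewrite (integral_map_mixture cX t01 k2_mix cj).
    set I := integral_map _ mu; set I1 := integral_map _ nu1.
    set I2 := integral_map _ nu2.
    (* The factor [t] comes out, leaving a convex combination of two differences, each at most twice
       the norm of [phi_ j]. *)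
    have -> : I - (s * (t * I1 + (1 - t) * I) + (1 - s) * (t * I2 + (1 - t) * I))
        = t * (s * (I - I1) + (1 - s) * (I - I2)) by ring.
    rewrite normrM (ger0_norm (ltW t0)) [2 * t]mulrC -mulrA ler_pM2l//.
    case/andP: s01 => s0 s1.
    have s1' : 0 <= 1 - s by lra.
    rewrite (le_trans (ler_normD _ _))// !normrM (ger0_norm s0) (ger0_norm s1').
    have := ler_wpM2l s0 (integral_map_dist cX mu nu1 cj).
    have := ler_wpM2l s1' (integral_map_dist cX mu nu2 cj).
    rewrite -/I -/I1 -/I2; lra.
  lra.
Qed.
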